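(* Let $n\ge1$, let $\mathcal T\neq0$ be a triangulated category and let $\mathcal X=\operatorname{add}\mathcal X$ be a functorially finite $(n+1)$ cluster tilting subcategory. Then the canonical suspension $\Sigma_{\mathcal X}$ of $\mathcal T/[\mathcal X]$ has nilpotency index exactly $n$: $$\min\{m\geq1\mid\Sigma_{\mathcal X}^{m}\cong\mathbf 0\}=n.$$ Equivalently, the canonical quotient $\mathcal T/[\mathcal X]$ is $n$-truncated and, for $n\ge2$, it is not $(n-1)$-truncated.
   Context: Subcategories are full and closed under isomorphisms; $\mathcal X=\operatorname{add}\mathcal X$ means closed under finite direct sums and direct summands. $[1]$ is the shift of $\mathcal T$. $\mathcal X$ is functorially finite if every $A\in\mathcal T$ admits a left $\mathcal X$-approximation (a morphism $A\to X_A$, $X_A\in\mathcal X$, through which every morphism from $A$ to an object of $\mathcal X$ factors) and, dually, a right $\mathcal X$-approximation $X^A\to A$. $\mathcal X$ is $(n+1)$ cluster tilting if it is functorially finite and $$\mathcal X=\{A\mid\mathcal T(A,X[i])=0\ \forall X\in\mathcal X,\ 1\le i\le n\}=\{A\mid\mathcal T(X,A[i])=0\ \forall X\in\mathcal X,\ 1\le i\le n\}.$$ $\mathcal T/[\mathcal X]$ is the ideal quotient by the morphisms factoring through objects of $\mathcal X$, with quotient functor $\pi_{\mathcal X}$. Its canonical pretriangulated structure has suspension $\Sigma_{\mathcal X}$ given by $\Sigma_{\mathcal X}(\pi_{\mathcal X}A)=\pi_{\mathcal X}(A^+)$, where $A\to X_A\to A^+\to A[1]$ is a chosen distinguished triangle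 whose first morphism is a left $\mathcal X$-approximation (on morphisms: complete $f:A\to B$ to a morphism $(f,g,h)$ of the chosen triangles and take $\pi_{\mathcal X}h$), and loop $\Omega_{\mathcal X}$ defined dually from distinguished triangles $A^-\to X^A\to A\to A^-[1]$ whose second morphism is a right $\mathcal X$-approximation; $\Sigma_{\mathcal X}$ is left adjoint to $\Omega_{\mathcal X}$. $\mathbf 0$ is the zero endofunctor. A pretriangulated category with suspension $\Sigma$ and loop $\Omega$ is $m$-truncated if $\Sigma^m\cong\mathbf 0$, equivalently $\Omega^m\cong\mathbf 0$. *)

(* Defs.v *)
From HB Require Import structures.
From mathcomp Require Import all_boot all_algebra.
From mathcomp Require Import ring_quotient boolp.

Set Implicit Arguments.
Unset Strict Implicit.
Unset Printing Implicit Defensive.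

Import GRing.Theory.
Import Quotient.

Local Open Scope ring_scope.

Declare Scope cat_scope.
Delimit Scope cat_scope with cat.
Local Open Scope cat_scope.

Record preadditive : Type := Preadditive {
  ob :> Type;
  hom : ob -> ob -> zmodType;
  idm : forall A, hom A A;
  comp : forall A B C, hom B C -> hom A B -> hom A C;
  comp_idl : forall A B (f : hom A B), comp (idm B) f = f;
  comp_idr : forall A B (f : hom A B), comp f (idm A) = f;
  comp_assoc : forall A B C D (f : hom A B) (g : hom B C) (h : hom C D),
    comp h (comp g f) = comp (comp h g) f;
  comp_addl : forall A B C (g g' : hom B C) (f : hom A B),
    comp (g + g') f = comp g f + comp g' f;
  comp_addr : forall A B C (g : hom B C) (f f' : hom A B),
    comp g (f + f') = comp g f + comp g f'
}.

Arguments idm {p} A.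
Arguments comp {p A B C} g f.

Notation "g ∘ f" := (comp g f) (at level 40, left associativity) : cat_scope.

Definition is_iso (C : preadditive) (A B : C) (f : hom A B) : Prop :=
  exists g : hom B A, g ∘ f = idm A /\ f ∘ g = idm B.

Definition isomorphic (C : preadditive) (A B : C) : Prop :=
  exists f : hom A B, is_iso f.

Definition is_biproduct (C : preadditive) (A B S : C)
    (iA : hom A S) (iB : hom B S) (pA : hom S A) (pB : hom S B) : Prop :=
  [/\ pA ∘ iA = idm A, pB ∘ iB = idm B, pB ∘ iA = 0, pA ∘ iB = 0
    & iA ∘ pA + iB ∘ pB = idm S].

Definition biproduct_of (C : preadditive) (A B S : C) : Prop :=
  exists iA iB pA pB, @is_biproduct C A B S iA iB pA pB.

Record additive : Type := Additive {
  pcat :> preadditive;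
  zob : pcat;
  zob_initial : forall (A : pcat) (f : hom zob A), f = 0;
  zob_terminal : forall (A : pcat) (f : hom A zob), f = 0;
  biproduct_ex : forall A B : pcat, exists S : pcat, biproduct_of A B S
}.

Arguments zob {a}.

Record functor (C D : preadditive) : Type := Functor {
  fobj :> C -> D;
  fmap : forall A B : C, hom A B -> hom (fobj A) (fobj B);
  fmap_id : forall A : C, fmap (idm A) = idm (fobj A);
  fmap_comp : forall (A B E : C) (g : hom B E) (f : hom A B),
    fmap (g ∘ f) = fmap g ∘ fmap f;
  fmap_add : forall (A B : C) (f g : hom A B), fmap (f + g) = fmap f + fmap g
}.

Arguments fmap {C D} F {A B} f : rename.

Definition nat_iso (C D : preadditive) (F G : functor C D) : Prop :=
  exists eta : forall A : C, hom (F A) (G A),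
    (forall (A B : C) (f : hom A B), eta B ∘ fmap F f = fmap G f ∘ eta A) /\
    (forall A : C, is_iso (eta A)).

Section PreadditiveTheory.
Variable C : preadditive.
Implicit Types A B E : C.

Lemma comp0l A B E (f : hom A B) : (0 : hom B E) ∘ f = 0.
Proof. by apply: (addrI ((0 : hom B E) ∘ f)); rewrite -comp_addl !addr0. Qed.

Lemma comp0r A B E (g : hom B E) : g ∘ (0 : hom A B) = 0.
Proof. by apply: (addrI (g ∘ (0 : hom A B))); rewrite -comp_addr !addr0. Qed.

Lemma compNl A B E (g : hom B E) (f : hom A B) : (- g) ∘ f = - (g ∘ f).
Proof. by apply: (addrI (g ∘ f)); rewrite -comp_addl !subrr comp0l. Qed.

Lemma compNr A B E (g : hom B E) (f : hom A B) : g ∘ (- f) = - (g ∘ f).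
Proof. by apply: (addrI (g ∘ f)); rewrite -comp_addr !subrr comp0r. Qed.

Lemma compBl A B E (g g' : hom B E) (f : hom A B) :
  (g - g') ∘ f = g ∘ f - g' ∘ f.
Proof. by rewrite comp_addl compNl. Qed.

Lemma compBr A B E (g : hom B E) (f f' : hom A B) :
  g ∘ (f - f') = g ∘ f - g ∘ f'.
Proof. by rewrite comp_addr compNr. Qed.

Lemma fmap0 (D : preadditive) (F : functor C D) A B :
  fmap F (0 : hom A B) = 0.
Proof. by apply: (addrI (fmap F (0 : hom A B))); rewrite -fmap_add !addr0. Qed.

Lemma fmapN (D : preadditive) (F : functor C D) A B (f : hom A B) :
  fmap F (- f) = - fmap F f.
Proof. by apply: (addrI (fmap F f)); rewrite -fmap_add !subrr fmap0. Qed.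

Lemma fmapB (D : preadditive) (F : functor C D) A B (f g : hom A B) :
  fmap F (f - g) = fmap F f - fmap F g.
Proof. by rewrite fmap_add fmapN. Qed.

End PreadditiveTheory.

Section Functors.

Definition id_functor (C : preadditive) : functor C C :=
  @Functor C C id (fun A B f => f) (fun A => erefl) (fun A B E g f => erefl)
    (fun A B f g => erefl).

Variables (C D E : preadditive) (G : functor D E) (F : functor C D).

Definition comp_functor : functor C E.
Proof.
refine (@Functor C E (fun A => G (F A)) (fun A B f => fmap G (fmap F f)) _ _ _).
- by move=> A; rewrite !fmap_id.
- by move=> A B H g f; rewrite !fmap_comp.
- by move=> A B f g; rewrite !fmap_add.
Defined.

End Functors.

Definition zero_functor (C : preadditive) (D : additive) : functor C D.
Proof.
refine (@Functor C D (fun=> zob) (fun A B f => 0) _ _ _).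
- by move=> A; rewrite (zob_initial (idm _)).
- by move=> A B E g f; rewrite comp0l.
- by move=> A B f g; rewrite addr0.
Defined.

Fixpoint iter_functor (C : preadditive) (F : functor C C) (m : nat) :
    functor C C :=
  if m is m'.+1 then comp_functor F (iter_functor F m') else id_functor C.

Definition is_equivalence (C D : preadditive) (F : functor C D) : Prop :=
  exists G : functor D C,
    nat_iso (comp_functor G F) (id_functor C) /\
    nat_iso (comp_functor F G) (id_functor D).

(* The shift is only required to be an additive autoequivalence, and
   [dist f g h] says that A -f-> B -g-> C -h-> A[1] is distinguished.
   [dist_iso], [dist_id], [dist_cone] are TR1; [dist_rot], [dist_mor],
   [dist_octa] are TR2, TR3, TR4. *)
Record triangulated : Type := Triangulated {
  tcat :> additive;
  shift : functor tcat tcat;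
  shift_equiv : is_equivalence shift;
  dist : forall A B C : tcat, hom A B -> hom B C -> hom C (shift A) -> Prop;
  dist_iso : forall (A B C A' B' C' : tcat)
      (f : hom A B) (g : hom B C) (h : hom C (shift A))
      (f' : hom A' B') (g' : hom B' C') (h' : hom C' (shift A'))
      (a : hom A A') (b : hom B B') (c : hom C C'),
    is_iso a -> is_iso b -> is_iso c ->
    b ∘ f = f' ∘ a -> c ∘ g = g' ∘ b -> fmap shift a ∘ h = h' ∘ c ->
    dist f g h -> dist f' g' h';
  dist_id : forall A : tcat, dist (idm A) (0 : hom A zob) 0;
  dist_cone : forall (A B : tcat) (f : hom A B),
    exists (C : tcat) (g : hom B C) (h : hom C (shift A)), dist f g h;
  dist_rot : forall (A B C : tcat)
      (f : hom A B) (g : hom B C) (h : hom C (shift A)),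
    dist f g h <-> dist g h (- fmap shift f);
  dist_mor : forall (A B C A' B' C' : tcat)
      (f : hom A B) (g : hom B C) (h : hom C (shift A))
      (f' : hom A' B') (g' : hom B' C') (h' : hom C' (shift A'))
      (a : hom A A') (b : hom B B'),
    dist f g h -> dist f' g' h' -> b ∘ f = f' ∘ a ->
    exists c : hom C C', c ∘ g = g' ∘ b /\ fmap shift a ∘ h = h' ∘ c;
  dist_octa : forall (A B C C' A' B' : tcat)
      (f : hom A B) (g : hom B C)
      (j : hom B C') (k : hom C' (shift A))
      (l : hom C A') (i : hom A' (shift B))
      (m : hom C B') (n : hom B' (shift A)),
    dist f j k -> dist g l i -> dist (g ∘ f) m n ->
    exists (u : hom C' B') (v : hom B' A'),
      [/\ dist u v (fmap shift j ∘ i), u ∘ j = m ∘ g, n ∘ u = k,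
          v ∘ m = l & i ∘ v = fmap shift f ∘ n]
}.

Arguments shift {t}.
Arguments dist {t A B C} f g h.

Notation "A ⟦ i ⟧" := (iter_functor shift i A)
  (at level 8, format "A ⟦ i ⟧") : cat_scope.

Section EquivalenceTheory.
Variables (C D : preadditive) (F : functor C D).
Hypothesis F_equiv : is_equivalence F.

Lemma equivalence_faithful (A B : C) (f g : hom A B) :
  fmap F f = fmap F g -> f = g.
Proof.
case: F_equiv => G [[eta [eta_nat eta_iso]] _] Ffg.
have [r [_ etar]] := eta_iso A.
have := eta_nat A B f; have := eta_nat A B g.
rewrite /= Ffg => -> /(congr1 (fun x => x ∘ r)).
by rewrite -!comp_assoc etar !comp_idr.
Qed.

Lemma equivalence_full (A B : C) (w : hom (F A) (F B)) :
  exists f : hom A B, fmap F f = w.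
Proof.
case: F_equiv => G [[eta [eta_nat eta_iso]] [eps [eps_nat eps_iso]]].
have [r [reta etar]] := eta_iso A.
have [s [seta etas]] := eta_iso B.
exists (eta B ∘ fmap G w ∘ r).
have Gw : fmap G (fmap F (eta B ∘ fmap G w ∘ r)) = fmap G w.
  have := eta_nat A B (eta B ∘ fmap G w ∘ r).
  rewrite /= -[_ ∘ r ∘ _]comp_assoc reta comp_idr.
  by move=> /(congr1 (fun x => s ∘ x)); rewrite !comp_assoc seta !comp_idl.
have [t [_ epst]] := eps_iso (F A).
have := eps_nat _ _ w; have := eps_nat _ _ (fmap F (eta B ∘ fmap G w ∘ r)).
rewrite /= Gw => -> /(congr1 (fun x => x ∘ t)).
by rewrite -!comp_assoc epst !comp_idr.
Qed.

End EquivalenceTheory.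

Section TriangulatedTheory.
Variable T : triangulated.
Implicit Types A B C : T.

Lemma dist_comp0 A B C (f : hom A B) (g : hom B C) (h : hom C (shift A)) :
  dist f g h -> g ∘ f = 0.
Proof.
move=> fgh.
have [|c [+ _]] := dist_mor (a := idm A) (b := f) (dist_id A) fgh.
  by [].
by rewrite comp0r => <-.
Qed.

Lemma dist_lift A B C (f : hom A B) (g : hom B C) (h : hom C (shift A)) D
    (t : hom D C) :
  dist f g h -> h ∘ t = 0 -> exists s : hom D B, t = g ∘ s.
Proof.
move=> fgh ht0.
have tri1 := (dist_rot _ _ _).1 (dist_id D).
have tri2 := (dist_rot _ _ _).1 ((dist_rot _ _ _).1 fgh).
have [|w [_]] :=
  dist_mor (a := t) (b := 0 : hom zob (shift A)) tri1 tri2.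
  by rewrite comp0r ht0.
rewrite fmap_id compNr comp_idr compNl => /oppr_inj tw.
have [s sw] := equivalence_full (shift_equiv T) w.
exists s; apply: (equivalence_faithful (shift_equiv T)).
by rewrite fmap_comp sw.
Qed.

Lemma dist_conn0 A B C (f : hom A B) (g : hom B C) (h : hom C (shift A)) :
  dist f g h -> fmap shift f ∘ h = 0.
Proof.
move=> /dist_rot/dist_rot/dist_comp0; rewrite compNl => /eqP.
by rewrite oppr_eq0 => /eqP.
Qed.

End TriangulatedTheory.

(* A full subcategory closed under isomorphisms is a predicate on objects. *)
Record add_subcategory (C : additive) : Type := AddSubcategory {
  mem_sub :> C -> Prop;
  sub_iso : forall A B : C, isomorphic A B -> mem_sub A -> mem_sub B;
  sub_zero : mem_sub zob;
  sub_sum : forall A B S : C,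
    biproduct_of A B S -> mem_sub A -> mem_sub B -> mem_sub S;
  sub_summand : forall A B S : C, biproduct_of A B S -> mem_sub S -> mem_sub A
}.

Section Approximations.
Variables (C : additive) (X : add_subcategory C).

Definition left_approx (A XA : C) (a : hom A XA) : Prop :=
  X XA /\ forall (Y : C) (f : hom A Y), X Y -> exists g : hom XA Y, f = g ∘ a.

Definition right_approx (XA A : C) (a : hom XA A) : Prop :=
  X XA /\ forall (Y : C) (f : hom Y A), X Y -> exists g : hom Y XA, f = a ∘ g.

Definition functorially_finite : Prop :=
  forall A : C, (exists (XA : C) (a : hom A XA), left_approx a) /\
                (exists (XA : C) (a : hom XA A), right_approx a).

End Approximations.

Definition hom_zero (C : preadditive) (A B : C) : Prop :=
  forall f : hom A B, f = 0.

(* [d] is the d of "d-cluster tilting": degrees 1, ..., d - 1 vanish. *)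
Definition cluster_tilting (T : triangulated) (d : nat)
    (X : add_subcategory T) : Prop :=
  [/\ functorially_finite X,
      forall A : T, X A <->
        (forall (Y : T) (i : nat), X Y -> (1 <= i <= d.-1)%N ->
           hom_zero A Y⟦i⟧)
    & forall A : T, X A <->
        (forall (Y : T) (i : nat), X Y -> (1 <= i <= d.-1)%N ->
           hom_zero Y A⟦i⟧)].

Section IdealQuotient.
Variables (C : additive) (X : add_subcategory C).

Definition factors_through (A B : C) (f : hom A B) : Prop :=
  exists (Y : C) (u : hom A Y) (v : hom Y B), X Y /\ f = v ∘ u.

Definition ideal (A B : C) : pred (hom A B) := fun f => `[<factors_through f>].

Lemma ideal_zmod_closed (A B : C) : zmod_closed (@ideal A B).
Proof.
split.
  by apply/asboolP; exists zob, 0, 0; rewrite comp0l; split=> //; apply: sub_zero.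
move=> f g /asboolP [Y [u [v [XY ->]]]] /asboolP [Z [w [x [XZ ->]]]].
apply/asboolP.
have [S YZS] := biproduct_ex Y Z.
have XS := sub_sum YZS XY XZ.
case: YZS => iY [iZ [pY [pZ [e1 e2 e3 e4 _]]]].
exists S, (iY ∘ u + iZ ∘ w), (v ∘ pY - x ∘ pZ); split=> //.
rewrite compBl !comp_addr -!comp_assoc.
rewrite [pY ∘ (iY ∘ u)]comp_assoc [pY ∘ (iZ ∘ w)]comp_assoc.
rewrite [pZ ∘ (iY ∘ u)]comp_assoc [pZ ∘ (iZ ∘ w)]comp_assoc.
by rewrite e1 e2 e3 e4 !comp_idl !comp0l !comp0r addr0 add0r.
Qed.

HB.instance Definition _ (A B : C) :=
  GRing.isZmodClosed.Build (hom A B) (@ideal A B) (ideal_zmod_closed A B).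

Definition qhom (A B : C) : zmodType :=
  quot (GRing.ZmodClosed.clone (hom A B) (@ideal A B) _).

Definition qpi (A B : C) (f : hom A B) : qhom A B := \pi_(qhom A B)%qT f.

Definition qrep (A B : C) (f : qhom A B) : hom A B := repr f.

Lemma qpiK (A B : C) (f : qhom A B) : qpi (qrep f) = f.
Proof. exact: reprK. Qed.

Lemma qpi_eq (A B : C) (f g : hom A B) :
  qpi f = qpi g <-> factors_through (f - g).
Proof.
rewrite -[factors_through _]asboolE -[`[<_>]]/(ideal (f - g)).
have -> : ideal (f - g) = (qpi f == qpi g) by exact: idealrBE.
by split=> /eqP.
Qed.

Lemma qpiD (A B : C) (f g : hom A B) : qpi (f + g) = qpi f + qpi g.
Proof. exact: raddfD. Qed.

Lemma qpi0 (A B : C) : qpi (0 : hom A B) = 0.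
Proof. exact: raddf0. Qed.

Definition qcomp (A B E : C) (g : qhom B E) (f : qhom A B) : qhom A E :=
  qpi (qrep g ∘ qrep f).

Lemma qpi_comp (A B E : C) (g : hom B E) (f : hom A B) :
  qpi (g ∘ f) = qcomp (qpi g) (qpi f).
Proof.
apply: (@etrans _ _ (qpi (g ∘ qrep (qpi f)))); apply/qpi_eq.
  have /qpi_eq[Y [u [v [XY e]]]] : qpi f = qpi (qrep (qpi f)) by rewrite qpiK.
  by exists Y, u, (g ∘ v); rewrite -compBr e comp_assoc.
have /qpi_eq[Y [u [v [XY e]]]] : qpi g = qpi (qrep (qpi g)) by rewrite qpiK.
by exists Y, (u ∘ qrep (qpi f)), v; rewrite -compBl e comp_assoc.
Qed.

Definition quotient_preadditive : preadditive.
Proof.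
refine (@Preadditive C qhom (fun A => qpi (idm A)) qcomp _ _ _ _ _).
- by move=> A B f; rewrite -[f]qpiK -qpi_comp comp_idl.
- by move=> A B f; rewrite -[f]qpiK -qpi_comp comp_idr.
- move=> A B E F f g h; rewrite -[f]qpiK -[g]qpiK -[h]qpiK.
  by rewrite -!qpi_comp comp_assoc.
- move=> A B E g g' f; rewrite -[f]qpiK -[g]qpiK -[g']qpiK.
  by rewrite -qpiD -!qpi_comp -qpiD comp_addl.
- move=> A B E g f f'; rewrite -[f]qpiK -[f']qpiK -[g]qpiK.
  by rewrite -qpiD -!qpi_comp -qpiD comp_addr.
Defined.

Definition quotient : additive.
Proof.
refine (@Additive quotient_preadditive (zob : C) _ _ _).
- by move=> A f; rewrite -[f]qpiK (zob_initial (qrep f)); exact: qpi0.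
- by move=> A f; rewrite -[f]qpiK (zob_terminal (qrep f)); exact: qpi0.
- move=> A B; have [S [iA [iB [pA [pB [e1 e2 e3 e4 e5]]]]]] :=
    biproduct_ex (A : C) (B : C).
  exists S, (qpi iA), (qpi iB), (qpi pA), (qpi pB); split => /=.
  + by rewrite -qpi_comp e1.
  + by rewrite -qpi_comp e2.
  + by rewrite -qpi_comp e3 qpi0.
  + by rewrite -qpi_comp e4 qpi0.
  + by rewrite -!qpi_comp -qpiD e5.
Defined.

Definition quotient_functor : functor C quotient :=
  @Functor C quotient id qpi (fun=> erefl) qpi_comp qpiD.

End IdealQuotient.

(* A choice, for each A, of a triangle A -> X_A -> A^+ -> A[1] whose first
   morphism is a left approximation; A^+ is [plus_ob A]. *)
Record suspension_triangles (T : triangulated) (X : add_subcategory T) : Type :=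
  SuspensionTriangles {
    approx_ob : T -> T;
    plus_ob : T -> T;
    approx : forall A : T, hom A (approx_ob A);
    to_plus : forall A : T, hom (approx_ob A) (plus_ob A);
    conn : forall A : T, hom (plus_ob A) (shift A);
    triangle_dist : forall A : T, dist (approx A) (to_plus A) (conn A);
    triangle_approx : forall A : T, left_approx X (approx A)
  }.

Lemma suspension_triangles_ex (T : triangulated) (X : add_subcategory T) :
  functorially_finite X -> inhabited (suspension_triangles X).
Proof.
move=> ffX.
have F' (A : T) : {XA : T & {P : T & {a : hom A XA & {p : hom XA P &
    {c : hom P (shift A) | dist a p c /\ left_approx X a}}}}}.
  have [XA /cid[a aP]] := cid (ffX A).1.
  have [P /cid[p /cid[c apc]]] := cid (dist_cone a).
  by exists XA, P, a, p, c.
constructor.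
exact: (@SuspensionTriangles T X
  (fun A => projT1 (F' A))
  (fun A => projT1 (projT2 (F' A)))
  (fun A => projT1 (projT2 (projT2 (F' A))))
  (fun A => projT1 (projT2 (projT2 (projT2 (F' A)))))
  (fun A => proj1_sig (projT2 (projT2 (projT2 (projT2 (F' A))))))
  (fun A => (proj2_sig (projT2 (projT2 (projT2 (projT2 (F' A)))))).1)
  (fun A => (proj2_sig (projT2 (projT2 (projT2 (projT2 (F' A)))))).2)).
Qed.

Section Suspension.
Variables (T : triangulated) (X : add_subcategory T).
Variable D : suspension_triangles X.

Definition triangle_morphism (A B : T) (f : hom A B)
    (g : hom (approx_ob D A) (approx_ob D B))
    (h : hom (plus_ob D A) (plus_ob D B)) : Prop :=
  [/\ g ∘ approx D A = approx D B ∘ f,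
      h ∘ to_plus D A = to_plus D B ∘ g
    & fmap shift f ∘ conn D A = conn D B ∘ h].

Lemma triangle_morphism_ex (A B : T) (f : hom A B) :
  exists h, exists g, triangle_morphism f g h.
Proof.
have [_ lift] := triangle_approx D A; have [XB _] := triangle_approx D B.
have [g gP] := lift _ (approx D B ∘ f) XB.
have [h [h1 h2]] :=
  dist_mor (triangle_dist D A) (triangle_dist D B) (esym gP).
by exists h, g.
Qed.

Lemma triangle_morphism_uniq (A B : T) (f f' : hom A B) g g' h h' :
  triangle_morphism f g h -> triangle_morphism f' g' h' ->
  qpi X f = qpi X f' -> qpi X h = qpi X h'.
Proof.
move=> [_ _ fh] [_ _ fh'] /qpi_eq[Y [u [v [XY ff']]]]; apply/qpi_eq.
have [_ lift] := triangle_approx D A; have [XB _] := triangle_approx D B.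
have [w uw] := lift _ u XY.
have [|s hs] := dist_lift (t := h - h') (triangle_dist D B).
  rewrite compBr -fh -fh' -compBl -fmapB ff' uw !fmap_comp -!comp_assoc.
  by rewrite (dist_conn0 (triangle_dist D A)) !comp0r.
by exists (approx_ob D B), s, (to_plus D B).
Qed.

Definition plus_map (A B : T) (f : hom A B) : hom (plus_ob D A) (plus_ob D B) :=
  sval (cid (triangle_morphism_ex f)).

Definition suspension_map (A B : quotient X) (f : hom A B) :
    @hom (quotient X) (plus_ob D A) (plus_ob D B) :=
  qpi X (plus_map (qrep f)).

Lemma suspension_mapE (A B : T) (f : hom A B) g h :
  triangle_morphism f g h -> @suspension_map A B (qpi X f) = qpi X h.
Proof.
move=> fgh; rewrite /suspension_map /plus_map; case: cid => h' [g' fgh'] /=.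
exact: (triangle_morphism_uniq fgh' fgh (qpiK _)).
Qed.

Definition suspension : functor (quotient X) (quotient X).
Proof.
refine (@Functor (quotient X) (quotient X) (plus_ob D) suspension_map _ _ _).
- move=> A; apply: (@suspension_mapE _ _ _ (idm _)).
  by split; rewrite ?fmap_id !(comp_idl, comp_idr).
- move=> A B E g f; rewrite -[f]qpiK -[g]qpiK.
  have [fh [fg [e1 e2 e3]]] := triangle_morphism_ex (qrep f).
  have [gh [gg [e4 e5 e6]]] := triangle_morphism_ex (qrep g).
  rewrite (suspension_mapE (And3 e1 e2 e3)) (suspension_mapE (And3 e4 e5 e6)).
  rewrite -[LHS]/(suspension_map (qcomp _ _)) -[RHS]/(qcomp _ _) -!qpi_comp.
  apply: (@suspension_mapE _ _ _ (gg ∘ fg)); split.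
  + by rewrite -comp_assoc e1 !comp_assoc e4.
  + by rewrite -comp_assoc e2 !comp_assoc e5.
  + by rewrite fmap_comp -comp_assoc e3 !comp_assoc e6.
- move=> A B f g; rewrite -[f]qpiK -[g]qpiK.
  have [fh [fg [e1 e2 e3]]] := triangle_morphism_ex (qrep f).
  have [gh [gg [e4 e5 e6]]] := triangle_morphism_ex (qrep g).
  rewrite (suspension_mapE (And3 e1 e2 e3)) (suspension_mapE (And3 e4 e5 e6)).
  rewrite -!qpiD.
  apply: (@suspension_mapE _ _ _ (fg + gg)); split.
  + by rewrite comp_addl comp_addr e1 e4.
  + by rewrite comp_addl comp_addr e2 e5.
  + by rewrite fmap_add comp_addl comp_addr e3 e6.
Defined.

End Suspension.

Definition truncated (C : additive) (S : functor C C) (m : nat) : Prop :=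
  nat_iso (iter_functor S m) (zero_functor C C).

Definition is_min (P : nat -> Prop) (n : nat) : Prop :=
  P n /\ forall m, P m -> (n <= m)%N.

(* Main.v *)
From mathcomp Require Import all_boot all_algebra.
Import GRing.Theory.
Require Import Defs.

(** Write [Ext^i(A, X) = 0] for the vanishing of all morphisms from [A] to
    objects [Z[i]] with [Z] in [X].  In these terms [X] consists of the [A]
    with [Ext^i(A, X) = 0] for [1 <= i <= n], and the iterated suspension
    [Sigma^m] is zero exactly when the object [A^{+m}], got by applying
    [A |-> A^+] to [A] repeatedly, is in [X] for every [A]
    ([iter_suspension_zeroP]).  So everything is read off from the long exact
    sequence obtained by mapping the triangle [A -> X_A -> A^+ -> A[1]] to
    [Z[i]].

    Upper bound.  Since [X_A] is in [X], its groups [Ext^i(X_A, X)] vanish, and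
    passing from [A] to [A^+] moves each vanishing of [Ext^i] up to [Ext^{i+1}]
    ([ext_zero_plus]), while [Ext^1(A^+, X) = 0] comes for free because [A -> X_A]
    is a left approximation ([ext1_zero_plus]).  Hence [n] steps kill
    [Ext^1, ..., Ext^n], whatever [A] was ([iter_plus_mem]).

    Lower bound.  The same sequence shows that [Ext^i(A, X)] embeds into
    [Ext^{i+1}(A^+, X)] for [1 <= i <= n] ([ext_zero_of_plus]).  If
    [Sigma^m] is zero with [m < n], then [Ext^{m+1}(A^{+m}, X) = 0], so
    [Ext^1(A, X) = 0] for every [A].  Taking [A = Z[1]] with [Z] in [X] gives
    [Z = 0]; then [X] consists of zero objects only, so all the [Ext] conditions
    hold trivially, every object is in [X], and the category is zero. *)

Set Implicit Arguments.
Unset Strict Implicit.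
Unset Printing Implicit Defensive.

Local Open Scope ring_scope.
Local Open Scope cat_scope.

Lemma hom_zero_id (C : preadditive) (A : C) :
  idm A = 0 -> forall B : C, hom_zero A B /\ hom_zero B A.
Proof.
move=> A0 B; split=> f; first by rewrite -[f]comp_idr A0 comp0r.
by rewrite -[f]comp_idl A0 comp0l.
Qed.

Lemma isomorphic_zobP (C : additive) (A : C) :
  isomorphic A (zob : C) <-> idm A = 0.
Proof.
split=> [[f [g [<- _]]] | A0]; first by rewrite (zob_terminal f) comp0r.
exists 0, 0; split; first by rewrite comp0l A0.
by rewrite comp0l; apply/esym/zob_terminal.
Qed.

(** Dual to [dist_lift]: [t] extends to a morphism from the rotated triangle
    [B -> C -> A[1]] to the triangle [0 -> D -> D] on the identity of [D]. *)
Lemma dist_extend (T : triangulated) (A B C : T)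
    (f : hom A B) (g : hom B C) (h : hom C (shift A)) (D : T) (t : hom C D) :
  dist f g h -> t ∘ g = 0 -> exists s : hom (shift A) D, t = s ∘ h.
Proof.
move=> fgh tg0.
have szob0 : idm (shift (zob : T)) = 0.
  by rewrite -fmap_id (zob_initial (idm zob)) fmap0.
have triD : dist (0 : hom zob D) (idm D) (0 : hom D (shift zob)).
  apply/dist_rot; rewrite fmap0 oppr0.
  apply: (dist_iso (a := idm D) (b := idm D) (c := 0) _ _ _ _ _ _ (dist_id D)).
  - by exists (idm D); rewrite comp_idl.
  - by exists (idm D); rewrite comp_idl.
  - exists 0; rewrite !comp0l szob0; split=> //.
    exact/esym/zob_terminal.
  - by [].
  - by rewrite !comp0l.
  - by rewrite !comp0r.
have [|s [s1 _]] := dist_mor (a := 0) (b := t) ((dist_rot _ _ _).1 fgh) triD.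
  by rewrite tg0 comp0r.
by exists s; rewrite s1 comp_idl.
Qed.

Definition ext_zero (T : triangulated) (X : add_subcategory T) (i : nat)
    (A : T) : Prop :=
  forall Z : T, X Z -> hom_zero A Z⟦i⟧.

Section SuspensionTriangle.
Variables (T : triangulated) (X : add_subcategory T).
Variable D : suspension_triangles X.

Lemma ext_zero_plus (i : nat) (A : T) :
  ext_zero X i.+1 (approx_ob D A) -> ext_zero X i A ->
  ext_zero X i.+1 (plus_ob D A).
Proof.
move=> extXA extA Z XZ f.
have [|g ->] := dist_extend (t := f) (triangle_dist D A); first exact: extXA.
have [g' <-] := equivalence_full (shift_equiv T) g.
by rewrite (extA Z XZ g') fmap0 comp0l.
Qed.

(** A morphism [A^+ -> Z[1]] comes from some [A -> Z], which extends to [X_A]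
    by the approximation property; two consecutive maps of the triangle then
    compose to zero. *)
Lemma ext1_zero_plus (A : T) :
  ext_zero X 1 (approx_ob D A) -> ext_zero X 1 (plus_ob D A).
Proof.
move=> extXA Z XZ f.
have [|g ->] := dist_extend (t := f) (triangle_dist D A); first exact: extXA.
have [g' <-] := equivalence_full (shift_equiv T) (B := Z) g.
have [_ lift] := triangle_approx D A.
have [g'' ->] := lift _ g' XZ.
by rewrite fmap_comp -comp_assoc (dist_conn0 (triangle_dist D A)) comp0r.
Qed.

(** If [Ext^i(X_A, X) = 0], then composing with [A^+ -> A[1]] is injective on
    the morphisms from [A[1]] to [Z[i+1]]. *)
Lemma ext_zero_of_plus (i : nat) (A : T) :
  ext_zero X i (approx_ob D A) -> ext_zero X i.+1 (plus_ob D A) ->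
  ext_zero X i A.
Proof.
move=> extXA extAp Z XZ f; apply: (equivalence_faithful (shift_equiv T)).
have tri := (dist_rot _ _ _).1 (triangle_dist D A).
have [|s ->] := dist_extend (t := fmap shift f) tri.
  exact: (extAp Z XZ).
have [s' <-] := equivalence_full (shift_equiv T) s.
by rewrite (extXA Z XZ s') !fmap0 comp0l.
Qed.

Lemma quotient_id0P (A : T) :
  idm (A : quotient X) = 0 <-> factors_through X (idm A).
Proof.
rewrite -[idm A]subr0 -qpi_eq qpi0.
by split.
Qed.

Lemma iter_suspension_ob (m : nat) (A : T) :
  iter_functor (suspension D) m A = iter m (plus_ob D) A.
Proof. by elim: m => //= m ->. Qed.

(** An object is zero in the quotient when its identity factors through [X],
    that is, when it is a retract of an object of [X]; closure under retracts
    turns this into membership in [X]. *)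
Hypothesis retractX : forall A : T, factors_through X (idm A) -> X A.

Lemma iter_suspension_zeroP (m : nat) :
  nat_iso (iter_functor (suspension D) m)
          (zero_functor (quotient X) (quotient X)) <->
  forall A : T, X (iter m (plus_ob D) A).
Proof.
have id0P (A : T) : idm (A : quotient X) = 0 <-> X A.
  split=> [/quotient_id0P /retractX // | XA]; apply/quotient_id0P.
  by exists A, (idm A), (idm A); rewrite comp_idl.
split=> [[eta [_ eta_iso]] A | memX].
  rewrite -iter_suspension_ob; apply/id0P.
  apply/(@isomorphic_zobP (quotient X)).
  by exists (eta A); apply: eta_iso.
have id0 A : idm (iter_functor (suspension D) m A) = 0.
  by apply/id0P; rewrite iter_suspension_ob.
exists (fun A => 0); split=> [A B f | A].
  by rewrite comp0l comp0r.
exists 0; rewrite !comp0l id0; split=> //.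
exact/esym/(@zob_terminal (quotient X)).
Qed.

End SuspensionTriangle.

Section ClusterTilting.
Variables (n : nat) (T : triangulated) (X : add_subcategory T).
Variable D : suspension_triangles X.
Hypothesis ctX : cluster_tilting n.+1 X.

Lemma mem_extP (A : T) :
  X A <-> forall i : nat, (1 <= i <= n)%N -> ext_zero X i A.
Proof.
have [_ memX _] := ctX; rewrite memX; split=> extA.
  by move=> i ni Z XZ; apply: extA.
by move=> Z i XZ ni; apply: extA.
Qed.

Lemma ext_zero_approx_ob (i : nat) (A : T) :
  (1 <= i <= n)%N -> ext_zero X i (approx_ob D A).
Proof. by have [/mem_extP extXA _] := triangle_approx D A; apply: extXA. Qed.

Lemma retract_mem (A : T) : factors_through X (idm A) -> X A.
Proof.
move=> [Y [u [v [/mem_extP extY uv]]]]; apply/mem_extP => i ni Z XZ f.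
by rewrite -[f]comp_idr uv comp_assoc (extY i ni Z XZ (f ∘ v)) comp0l.
Qed.

Lemma iter_plus_ext_zero (m i : nat) (A : T) :
  (1 <= i <= m)%N -> (i <= n)%N -> ext_zero X i (iter m (plus_ob D) A).
Proof.
elim: m i => [|m IHm] [|[|i]] //= im ni.
  by apply: ext1_zero_plus; apply: ext_zero_approx_ob.
apply: ext_zero_plus; first exact: ext_zero_approx_ob.
by apply: IHm => //; apply: ltnW.
Qed.

Lemma iter_plus_mem (A : T) : X (iter n (plus_ob D) A).
Proof.
by apply/mem_extP => i /andP[i1 ni]; apply: iter_plus_ext_zero; rewrite ?i1.
Qed.

Lemma ext1_zero_of_iter_plus (m : nat) (A : T) :
  (m <= n)%N -> ext_zero X m.+1 (iter m (plus_ob D) A) -> ext_zero X 1 A.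
Proof.
elim: m => //= m IHm mn extA; apply: IHm; first exact: ltnW.
by apply: ext_zero_of_plus extA; apply: ext_zero_approx_ob.
Qed.

(** Testing [Ext^1] on [Z[1]] shows that the objects [Z] of [X] are zero, so
    that the conditions defining membership in [X] hold for every object. *)
Lemma ext1_zero_trivial :
  (forall A : T, ext_zero X 1 A) -> forall A : T, isomorphic A (zob : T).
Proof.
move=> ext1 A; apply/isomorphic_zobP.
have id0 (Z : T) : X Z -> idm Z = 0.
  move=> XZ; apply: (equivalence_faithful (shift_equiv T)).
  by rewrite fmap0; apply: (ext1 (shift Z) Z XZ).
apply: (id0 A); apply/mem_extP => i _ Z XZ.
apply: (hom_zero_id _ _).2.
by rewrite -(fmap_id (iter_functor shift i)) (id0 Z XZ) fmap0.
Qed.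

Lemma iter_plus_mem_leq (m : nat) :
  (exists A : T, ~ isomorphic A (zob : T)) ->
  (forall A : T, X (iter m (plus_ob D) A)) -> (n <= m)%N.
Proof.
move=> [B nzB] memX; rewrite leqNgt; apply/negP => mn; apply: nzB.
apply: ext1_zero_trivial => A.
apply: (@ext1_zero_of_iter_plus m); first exact: ltnW.
by have /mem_extP := memX A; apply.
Qed.

End ClusterTilting.

Theorem corollary3p21 (n : nat) (T : triangulated) (X : add_subcategory T)
    (D : suspension_triangles X) :
  (1 <= n)%N ->
  (exists A : T, ~ isomorphic A (zob : T)) ->
  cluster_tilting n.+1 X ->
  is_min (fun m => (1 <= m)%N /\
            nat_iso (iter_functor (suspension D) m)
                    (zero_functor (quotient X) (quotient X))) n /\
  truncated (suspension D) n /\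
  ((2 <= n)%N -> ~ truncated (suspension D) n.-1).
Proof.
move=> n1 nzT ctX.
have zeroP := iter_suspension_zeroP D (retract_mem ctX).
have trn : truncated (suspension D) n.
  by apply/zeroP => A; apply: iter_plus_mem.
have minn m : truncated (suspension D) m -> (n <= m)%N.
  by move=> /zeroP; apply: iter_plus_mem_leq.
split; first by split=> // m [_]; apply: minn.
split=> // n2 /minn.
by rewrite leqNgt prednK ?leqnn.
Qed.
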